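(* For every $q \geq 2$ and $n \geq 2$ we have $$2^{\frac{2}{3}\, n^{q-1}/\sqrt{q}} \leq N_3(q,n) \leq 2^{2n^{q-1}} .$$
   Context: All parameters are integers. Let $K^3_N$ denote the complete $3$-uniform hypergraph on the ordered vertex set $\{1,\ldots,N\}$, i.e. all $3$-element subsets of $\{1,\ldots,N\}$. For vertices $x_1<x_2<\cdots<x_{n+2}$, the $n$ edges $\{x_i,x_{i+1},x_{i+2}\}$, $1\le i\le n$, form a monotone path of length $n$ (length is the number of edges). $N_3(q,n)$ is the smallest integer $N$ such that every coloring of the edges of $K^3_N$ with $q$ colors contains a monochromatic monotone path of length $n$ (all $n$ edges having the same color). *)

(* Defs.v *)
From mathcomp Require Import all_boot.

Set Implicit Arguments.
Unset Strict Implicit.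
Unset Printing Implicit Defensive.

(* The ordered vertex set {1, ..., N} is rendered by 'I_N with its usual      *)
(* order, i.e., shifted to {0, ..., N - 1}.                                   *)
Definition edge3 (N : nat) : finType := {e : {set 'I_N} | #|e| == 3}.

Definition coloring (q N : nat) : finType := {ffun edge3 N -> 'I_q}.

Definition vertices (n N : nat) : finType := {ffun 'I_n.+2 -> 'I_N}.

Definition increasing (n N : nat) (x : vertices n N) : bool :=
  [forall i : 'I_n.+2, forall j : 'I_n.+2, (i < j) ==> (x i < x j)].

(* As i < n, the indices i, i.+1, i.+2 are below n.+2 and inord is exact.     *)
Definition path_edge (n N : nat) (x : vertices n N) (i : 'I_n) : {set 'I_N} :=
  [set x (inord i); x (inord i.+1); x (inord i.+2)].

(* When x is increasing every path_edge x i has three elements, so exactly    *)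
(* one e : edge3 N satisfies the premise below.                               *)
Definition monochromatic (q n N : nat) (chi : coloring q N)
    (x : vertices n N) : bool :=
  [exists c : 'I_q, [forall i : 'I_n, [forall e : edge3 N,
    (val e == path_edge x i) ==> (chi e == c)]]].

Definition forces_path (q n N : nat) : bool :=
  [forall chi : coloring q N, [exists x : vertices n N,
    increasing x && monochromatic chi x]].

(* Existence of N3: if edge {h, i, j} has color c and F h i = F i j, where     *)
(* F i j is the set of (c, k) such that a c-colored path of length k ends in  *)
(* (i, j), then there are c-colored paths of all lengths up to n at (i, j). *)
(* Such h < i < j exist for large N, since otherwise i |-> {F i j | i < j}    *)
(* would be injective.                                                        *)
Section Existence.
Variables (q n N : nat) (chi : coloring q N).

Fixpoint reach (c : 'I_q) (k : nat) (i j : 'I_N) : bool :=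
  if k is k'.+1 then
    [exists h : 'I_N, [&& h < i, i < j, reach c k' h i &
      [exists e : edge3 N, (val e == [set h; i; j]) && (chi e == c)]]]
  else i < j.

Lemma reach_path c k i j : reach c k i j -> exists x : nat -> 'I_N,
  [/\ x k = i, x k.+1 = j, forall a, a <= k -> x a < x a.+1 &
      forall a, a < k -> forall e : edge3 N,
        val e = [set x a; x a.+1; x a.+2] -> chi e = c].
Proof.
elim: k i j => [|k IHk] i j /=.
  move=> lt_ij; exists (fun a => if a is 0 then i else j); split=> //.
  by case.
case/existsP=> h /and4P[lt_hi lt_ij /IHk[x [xk xk1 incx colx]]].
case/existsP=> e0 /andP[/eqP e0E /eqP e0c].
exists (fun a => if a <= k.+1 then x a else j); split; cbv beta.
- by rewrite leqnn.
- by rewrite ltnn.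
- move=> a /[dup]; rewrite {1}leq_eqVlt => /predU1P[->|lt_ak] le_ak.
    by rewrite leqnn ltnn xk1.
  by rewrite le_ak lt_ak incx.
move=> a; rewrite {1}ltnS {1}leq_eqVlt => /predU1P[->|lt_ak] e.
  rewrite leqnn leqnSn ltnn xk xk1 -e0E => /val_inj ->; exact: e0c.
rewrite (leqW (ltnW lt_ak)) (leqW lt_ak) ltnS lt_ak; exact: colx.
Qed.

Lemma reach_mono c i j : reach c n i j ->
  [exists x : vertices n N, increasing x && monochromatic chi x].
Proof.
case/reach_path=> x [_ _ incx colx].
apply/existsP; exists [ffun a : 'I_n.+2 => x a]; apply/andP; split.
  have H a d : a + d <= n -> x a < x (a + d).+1.
    elim: d => [|d IHd]; first by rewrite addn0; apply: incx.
    rewrite addnS => le_adn; apply: ltn_trans (IHd (ltnW le_adn)) _.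
    exact: incx.
  apply/forallP=> a; apply/forallP=> b; apply/implyP=> lt_ab; rewrite !ffunE.
  have := H a (b - a.+1); rewrite -addSn subnKC //; apply.
  by rewrite -ltnS -addSn subnKC // -ltnS ltn_ord.
apply/existsP; exists c; apply/forallP=> a; apply/forallP=> e.
apply/implyP=> /eqP eE; apply/eqP/(colx a) => //; rewrite eE /path_edge !ffunE.
by rewrite !inordK // ?ltnS ?(ltnW (ltn_ord a)) // ltnW // ltnS ltnW.
Qed.

Let F i j : {set 'I_q * 'I_n.+1} :=
  [set u : 'I_q * 'I_n.+1 | reach u.1 u.2 i j].
Let A j := [set F j k | k in [set k : 'I_N | j < k]].

Lemma forces_path_large : #|{set {set 'I_q * 'I_n.+1}}| < N ->
  [exists x : vertices n N, increasing x && monochromatic chi x].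
Proof.
move=> largeN.
have /injectivePn[i0 [j0 ne_ij eqA]] : ~~ injectiveb A.
  apply/negP=> /injectiveP injA.
  by have := leq_card A injA; rewrite card_ord leqNgt largeN.
wlog lt_ij : i0 j0 ne_ij eqA / i0 < j0.
  move=> IH; case: (ltngtP i0 j0) => [|lt|/val_inj eq]; first exact: IH.
    by apply: (IH j0 i0) => //; rewrite eq_sym.
  by rewrite eq eqxx in ne_ij.
have : F i0 j0 \in A j0 by rewrite -eqA; apply: imset_f; rewrite inE.
case/imsetP=> l; rewrite inE => lt_jl eqF.
have card3 : #|[set i0; j0; l]| == 3.
  rewrite -setUA cardsU1 cards2 !inE negb_or -!val_eqE /=.
  by rewrite !neq_ltn lt_ij lt_jl (ltn_trans lt_ij lt_jl).
pose e : edge3 N := exist (fun e : {set 'I_N} => #|e| == 3) _ card3.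
suff H k : k <= n -> reach (chi e) k j0 l by apply: reach_mono (H n _).
elim: k => [|k IHk] // lt_kn; apply/existsP; exists i0.
have : (chi e, Ordinal (leqW lt_kn)) \in F i0 j0.
  by rewrite eqF inE; apply/IHk/ltnW.
rewrite inE => reach_k; apply/and4P; split=> //.
by apply/existsP; exists e; rewrite !eqxx.
Qed.

End Existence.

Lemma forces_path_ex (q n : nat) : exists N, forces_path q n N.
Proof.
exists #|{set {set 'I_q * 'I_n.+1}}|.+1.
by apply/forallP=> chi; apply: forces_path_large.
Qed.

Definition N3 (q n : nat) : nat := ex_minn (forces_path_ex q n).

(* Main.v *)
Require Import Defs.
From mathcomp Require Import all_boot all_order all_algebra.
From mathcomp Require Import reals exp.
From mathcomp Require Import ring lra zify.

(** A coloring of the triples gives each pair i < j a vector in the grid [n]^q: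
    its c-th entry is the length of the longest c-colored monotone path ending
    in (i, j). If {i, j, k} has color c, the c-th entry grows from (i, j) to
    (j, k). Hence a coloring of K^3_N without monochromatic path of length n is
    the same thing as a function F from the pairs of vertices to the product
    order [n]^q such that F(j, k) <= F(i, j) for no i < j < k.

    Upper bound. Attach to the vertex j the up-set of [n]^q generated by all
    F(j, k), k > j. For i < j the point F(i, j) lies in the up-set of i and not
    in that of j, so the up-sets are pairwise distinct
    ([upsets_of_avoiding]), and N is at most the number of up-sets. An up-set
    of [n]^q is cut by the planes parallel to the first two axes into
    n^(q-2) staircases in [n]^2, each of which is encoded by a nonempty subset
    of [2n] ([code_inj]). This leaves fewer than 2^(2 n^(q-1)) up-sets.

    Lower bound. Let A be an antichain of [n]^q, and list the subsets of A so
    that no set is contained in a later one. Choosing F(i, j) in the i-th set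
    but not in the j-th one satisfies the condition above: F(j, k) and F(i, j)
    are distinct elements of A. So N_3(q, n) > 2^|A| ([antichain_bound]).
    The layers of [n]^q with constant coordinate sum are antichains, and one
    of them is large because the coordinate sum of a random point has small
    variance: among the integer distributions with point masses at most p,
    the variance is at least (1/p^2 - 1)/12, the value for the uniform one,
    while here it is q(n^2 - 1)/12. This gives a layer of proportion at least
    1/sqrt(q(n^2 - 1) + 1) >= 1/(n sqrt q) ([large_layer]), that
    is, of size at least n^(q-1)/sqrt q. *)

Set Implicit Arguments.
Unset Strict Implicit.
Unset Printing Implicit Defensive.

Import Order.TTheory GRing.Theory Num.Theory.

(** * Sorted triples *)

(** Recovers the order of the vertices of a triple, which a coloring of
    unordered triples does not see. *)
Lemma enum_edge (N : nat) (i j k : 'I_N) : i < j -> j < k ->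
  enum [set i; j; k] = [:: i; j; k].
Proof.
move=> ij jk.
apply: (@irr_sorted_eq _ (relpre val ltn)).
- by move=> a b c; apply: ltn_trans.
- by move=> a; rewrite /= ltnn.
- apply: sorted_filter; first by move=> a b c; apply: ltn_trans.
  by rewrite -enumT -sorted_map val_enum_ord iota_ltn_sorted.
- by rewrite /= ij jk.
by move=> a; rewrite mem_enum !inE orbA.
Qed.

(** * The upper bound: counting up-sets of the grid *)

(** Deleting the first vertices of a path shortens it without changing its last
    two vertices. *)
Lemma reachW (q N : nat) (chi : coloring q N) c k l (i j : 'I_N) :
  k <= l -> reach chi c l i j -> reach chi c k i j.
Proof.
elim: l k i j => [|l IH] [|k] i j // kl.
  by case/existsP=> h /and4P[].
case/existsP=> h /and4P[hi ij rh e]; apply/existsP; exists h.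
by apply/and4P; split=> //; apply: IH rh.
Qed.

(** The color is that of {i, j, k}: this edge prolongs every path of its color
    that ends in (i, j). *)
Lemma reach_step (q N : nat) (chi : coloring q N) (i j k : 'I_N) :
  i < j -> j < k ->
  exists c, forall l, reach chi c l i j -> reach chi c l.+1 j k.
Proof.
move=> ij jk.
have card3 : #|[set i; j; k]| == 3 by rewrite cardE enum_edge.
pose e : edge3 N := exist (fun e : {set 'I_N} => #|e| == 3) _ card3.
exists (chi e) => l r; apply/existsP; exists i; apply/and4P; split=> //.
by apply/existsP; exists e; rewrite !eqxx.
Qed.

Definition upset (q n : nat) (U : {set {ffun 'I_q -> 'I_n}}) :=
  forall v w : {ffun 'I_q -> 'I_n}, v \in U -> (forall c, v c <= w c) -> w \in U.

(** For i < j, the vector of the lengths of the longest paths ending in (i, j)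
    separates the up-set of i from that of j. *)
Lemma upsets_of_avoiding (q n N : nat) : 0 < n -> ~~ forces_path q n N ->
  exists2 U : 'I_N -> {set {ffun 'I_q -> 'I_n}},
    injective U & forall i, upset (U i).
Proof.
move=> n0; rewrite negb_forall => /existsP[chi hchi].
have bnd c i j : ~~ reach chi c n i j.
  by apply: contra hchi => /reach_mono.
(* The condition on k says that v is at least the vector of the lengths of the
   longest paths ending in (j, k). *)
pose U (j : 'I_N) : {set {ffun 'I_q -> 'I_n}} :=
  [set v : {ffun 'I_q -> 'I_n} | [exists k : 'I_N,
    (j < k) && [forall c, ~~ reach chi c (v c).+1 j k]]].
exists U; last first.
  move=> j v w; rewrite !inE => /existsP[k /andP[jk /forallP h]] vw.
  apply/existsP; exists k; rewrite jk; apply/forallP => c.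
  by apply: contra (h c); apply: reachW; rewrite ltnS.
have ne (i j : 'I_N) : i < j -> U i <> U j.
  move=> ij eqU.
  have /fin_all_exists[f hf] : forall c, exists a : 'I_n,
      reach chi c a i j && ~~ reach chi c a.+1 i j.
    move=> c.
    case: (@arg_maxnP _ (Ordinal n0) (fun a : 'I_n => reach chi c a i j) val ij).
    move=> a ra amax; exists a; rewrite ra; apply/negP => ra1.
    have [an|na] := ltnP a.+1 n; last first.
      by case/negP: (bnd c i j); apply: reachW ra1.
    by have := amax (Ordinal an) ra1; rewrite /= ltnn.
  have : finfun f \in U i.
    rewrite inE; apply/existsP; exists j; rewrite ij; apply/forallP => c.
    by rewrite ffunE; case/andP: (hf c).
  rewrite eqU inE => /existsP[k /andP[jk /forallP h]].
  have [c hc] := reach_step chi ij jk.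
  by move: (h c); rewrite ffunE => /negP; apply; apply: hc; case/andP: (hf c).
move=> i j eqU; case: (ltngtP i j) => [ij|ji|/val_inj ij].
- by case: (ne _ _ ij eqU).
- by case: (ne _ _ ji (esym eqU)).
- exact: ij.
Qed.

(** Sorting the image recovers the sequence. *)
Lemma ltn_homo_image_inj (n : nat) (f g : 'I_n -> nat) :
  {homo f : i j / i < j} -> {homo g : i j / i < j} ->
  (forall s, [exists i, f i == s] = [exists i, g i == s]) -> f =1 g.
Proof.
move=> hf hg E.
have srt (h : 'I_n -> nat) : {homo h : i j / i < j} -> sorted ltn (codom h).
  move=> hh; rewrite /codom /image_mem sorted_map.
  apply: (@sub_sorted _ (relpre val ltn)); first exact: hh.
  by rewrite -sorted_map enumT -enumT val_enum_ord iota_ltn_sorted.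
have : codom f = codom g.
  apply: (irr_sorted_eq ltn_trans ltnn (srt f hf) (srt g hg)) => s.
  have P (h : 'I_n -> nat) : (s \in codom h) = [exists i, h i == s].
    apply/codomP/existsP => [[i ->]|[i /eqP <-]]; by exists i.
  by rewrite !P E.
by rewrite /codom /image_mem => /eq_in_map H i; apply: H; rewrite mem_enum.
Qed.

Definition glue (p n : nat) (i j : 'I_n) (w : {ffun 'I_p -> 'I_n}) :
    {ffun 'I_p.+2 -> 'I_n} :=
  [ffun c => if unlift ord0 c is Some c' then
     if unlift ord0 c' is Some c'' then w c'' else j else i].

Lemma glueK (p n : nat) (v : {ffun 'I_p.+2 -> 'I_n}) :
  glue (v ord0) (v (lift ord0 ord0)) [ffun c => v (lift ord0 (lift ord0 c))] = v.
Proof.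
apply/ffunP=> c; rewrite ffunE; case: unliftP => [c'|] -> //.
by case: unliftP => [c''|] -> //; rewrite ffunE.
Qed.

Lemma glue_le (p n : nat) (i j i' j' : 'I_n) (w : {ffun 'I_p -> 'I_n}) c :
  i <= i' -> j <= j' -> glue i j w c <= glue i' j' w c.
Proof.
by move=> ii jj; rewrite !ffunE; case: unliftP => [c'|] // _; case: unliftP.
Qed.

(** A is nested with the set of the j >= i, so that comparing the two sets
    amounts to comparing their cardinalities. *)
Lemma mem_final_segment (n : nat) (A : {set 'I_n}) :
  (forall i j : 'I_n, i \in A -> i <= j -> j \in A) ->
  forall i, (i \in A) = (n - i <= #|A|).
Proof.
move=> hA i; have cge : #|[set j : 'I_n | i <= j]| = n - i.
  rewrite -sum1_card (eq_bigl (fun j : 'I_n => i <= j)) => [|j];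
    last by rewrite inE.
  rewrite -(big_mkord (fun j => i <= j) (fun=> 1)) (big_cat_nat (n := i)) //=;
    last exact: ltnW.
  rewrite big_nat_cond big_pred0 ?add0n; last by move=> j; rewrite ltnNge; lia.
  rewrite big_nat_cond (eq_bigl (fun j => (i <= j < n) && true)) => [|j];
    last lia.
  by rewrite -big_nat_cond sum_nat_const_nat muln1.
rewrite -cge; apply/idP/idP => [iA|].
  by apply: subset_leq_card; apply/subsetP=> j; rewrite inE; apply: hA.
apply: contraTT => niA; rewrite -ltnNge; apply: proper_card.
apply/properP; split; last by exists i; rewrite ?inE.
apply/subsetP=> j jA; rewrite inE leqNgt; apply: contra niA => ji.
by apply: hA jA _; apply: ltnW.
Qed.

Section Code.
Variables (p n : nat).
Implicit Types (U : {set {ffun 'I_p.+2 -> 'I_n}}) (w : {ffun 'I_p -> 'I_n}).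

Definition height U w (i : 'I_n) := #|[set j | glue i j w \in U]|.

(** In each plane section the column heights of an up-set increase weakly, so
    that adding the index of the column makes them strictly increasing: they
    can be recovered from the set of their values. *)
Definition code U : {set {ffun 'I_p -> 'I_n} * 'I_(2 * n)} :=
  [set u : {ffun 'I_p -> 'I_n} * 'I_(2 * n) |
    [exists i : 'I_n, i + height U u.1 i == u.2 :> nat]].

Lemma height_max U w i : height U w i <= n.
Proof. by rewrite -[X in _ <= X]card_ord max_card. Qed.

Lemma height_homo U w : upset U ->
  {homo (fun i : 'I_n => i + height U w i) : i j / i < j}.
Proof.
move=> hU i j ij; apply: leq_ltn_trans (_ : i + height U w j < _); last first.
  by rewrite ltn_add2r.
rewrite leq_add2l subset_leq_card //; apply/subsetP=> a.
rewrite !inE => /hU; apply.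
by move=> c; apply: glue_le => //; apply: ltnW.
Qed.

Lemma mem_height U w i j : upset U ->
  (glue i j w \in U) = (n - j <= height U w i).
Proof.
move=> hU; rewrite -mem_final_segment ?inE // => a b.
rewrite !inE => /hU h ab; apply: h.
by move=> c; apply: glue_le.
Qed.

Lemma code_inj U V : upset U -> upset V -> code U = code V -> U = V.
Proof.
move=> hU hV E.
suff H w : (fun i : 'I_n => i + height U w i) =1 (fun i => i + height V w i).
  by apply/setP=> v; rewrite -(glueK v) !mem_height // (addnI (H _ _)).
apply: ltn_homo_image_inj; [exact: height_homo|exact: height_homo|].
move=> s; have [sn|ns] := ltnP s (2 * n).
  by move/setP/(_ (w, Ordinal sn)): E; rewrite !inE.
apply/existsP/existsP => -[i /eqP si].
  by have := height_max U w i; have := ltn_ord i; lia.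
by have := height_max V w i; have := ltn_ord i; lia.
Qed.

(** That the code set0 is left out makes the count of up-sets strict, which compensates
    for N_3(q, n) being one more than this count. *)
Lemma code_neq0 U : 0 < n -> code U != set0.
Proof.
move=> n0; apply/set0Pn.
pose i := Ordinal n0; pose w : {ffun 'I_p -> 'I_n} := [ffun=> i].
have h : i + height U w i < 2 * n.
  by have := height_max U w i; rewrite /=; lia.
by exists (w, Ordinal h); rewrite inE; apply/existsP; exists i.
Qed.
End Code.

Lemma N3_upper (p n : nat) : 0 < n -> N3 p.+2 n <= 2 ^ (2 * n ^ p.+1).
Proof.
move=> n0; rewrite /N3; case: ex_minnP => N _; apply.
apply: contraT => /(upsets_of_avoiding n0) [U injU upU].
have injc : injective (fun i => code (U i)).
  by move=> i j /code_inj/injU; apply.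
pose C : {set {set {ffun 'I_p -> 'I_n} * 'I_(2 * n)}} :=
  [set code (U i) | i : 'I_(2 ^ (2 * n ^ p.+1))].
have : C \proper setT.
  rewrite properT; apply/negP => /eqP CT.
  have : set0 \in C by rewrite CT inE.
  by case/imsetP=> i _ /esym/eqP; apply/negP/code_neq0.
move/proper_card; rewrite card_imset // cardsT card_ord.
rewrite -cardsT -powersetT card_powerset cardsT card_prod card_ffun !card_ord.
by rewrite mulnCA -expnSr ltnn.
Qed.

(** * The lower bound: colorings from antichains *)

(** The subsets of A are listed by decreasing cardinality, so that none is
    contained in a later one. *)
Lemma subset_list (T : finType) (A : {set T}) (N : nat) : N <= 2 ^ #|A| ->
  exists S : 'I_N -> {set T}, forall i j : 'I_N, i < j ->
    exists2 x, x \in A & (x \in S i) && (x \notin S j).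
Proof.
move=> leN.
pose ge (B C : {set T}) := #|C| <= #|B|.
pose s := sort ge (enum (powerset A)).
have sz : size s = 2 ^ #|A| by rewrite size_sort -cardE card_powerset.
have us : uniq s by rewrite sort_uniq enum_uniq.
have ss : sorted ge s by apply: sort_sorted => B C; apply: leq_total.
have ge_tr : transitive ge by move=> B C D h1 h2; apply: leq_trans h2 h1.
exists (fun i => nth set0 s i) => i j lt_ij.
have si : i < size s by rewrite sz (leq_trans (ltn_ord i)).
have sj : j < size s by rewrite sz (leq_trans (ltn_ord j)).
have geij : ge (nth set0 s i) (nth set0 s j).
  by apply: (sorted_ltn_nth ge_tr) => //; rewrite inE.
have neij : nth set0 s i != nth set0 s j by rewrite nth_uniq // neq_ltn lt_ij.
have : ~~ (nth set0 s i \subset nth set0 s j).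
  apply: contra neij => sub; by rewrite eqEcard sub.
case/subsetPn=> x xi xj; exists x; last by rewrite xi.
have : nth set0 s i \in powerset A by rewrite -mem_enum -(mem_sort ge) mem_nth.
by rewrite inE => /subsetP; apply.
Qed.

(** Give {i, j, k} a color in which F grows from (i, j) to (j, k): along a
    monochromatic path of length n the corresponding entry of F, which is less
    than n, would have to grow n times. *)
Lemma avoid_path (q n N : nat) (F : 'I_N -> 'I_N -> {ffun 'I_q -> 'I_n}) :
  (forall i j k : 'I_N, i < j -> j < k -> exists c, F i j c < F j k c) ->
  1 < q -> 0 < n -> ~~ forces_path q n N.
Proof.
move=> hF q1 n0.
pose c0 : 'I_q := Ordinal (ltnW q1).
pose chi : coloring q N := [ffun e : edge3 N =>
  if enum (val e) is [:: i; j; k] then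
    odflt c0 [pick c | F i j c < F j k c] else c0].
apply/negP => /forallP /(_ chi) /existsP[x /andP[/forallP incx]].
case/existsP=> c /forallP mono.
have lt_x a b : a < b -> b < n.+2 -> x (inord a) < x (inord b).
  move=> ab bn; have /forallP /(_ (inord b)) := incx (inord a).
  by rewrite !inordK ?ab //; apply: ltn_trans bn.
have step a : a < n ->
    F (x (inord a)) (x (inord a.+1)) c < F (x (inord a.+1)) (x (inord a.+2)) c.
  move=> an; have l1 : x (inord a) < x (inord a.+1) by apply: lt_x => //; lia.
  have l2 : x (inord a.+1) < x (inord a.+2) by apply: lt_x => //; lia.
  have en := enum_edge l1 l2.
  have c3 : #|[set x (inord a); x (inord a.+1); x (inord a.+2)]| == 3.
    by rewrite cardE en.
  pose e : edge3 N := exist (fun e : {set 'I_N} => #|e| == 3) _ c3.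
  have /forallP /(_ e) := mono (Ordinal an).
  rewrite /path_edge /= eqxx /= ffunE /= en; case: pickP => [d hd /eqP <- //|h _].
  by have [d] := hF _ _ _ l1 l2; rewrite h.
have grow a : a <= n -> a <= F (x (inord a)) (x (inord a.+1)) c.
  elim: a => // a IH an; exact: leq_ltn_trans (IH (ltnW an)) (step _ an).
by have := grow n (leqnn n); rewrite leqNgt ltn_ord.
Qed.

(** F(i, j) is an element of A in the i-th subset and not in the j-th one; as
    F(j, k) is in the j-th subset, it differs from F(i, j) and hence is not
    below it. *)
Lemma antichain_bound (q n : nat) (A : {set {ffun 'I_q -> 'I_n}}) :
  1 < q -> 0 < n ->
  {in A &, forall v w : {ffun 'I_q -> 'I_n}, (forall c, v c <= w c) -> v = w} ->
  2 ^ #|A| < N3 q n.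
Proof.
move=> q1 n0 hA; rewrite ltnNge /N3; case: ex_minnP => N hN _.
apply/negP=> /subset_list[S hS]; move: hN; apply/negP.
pose v0 : {ffun 'I_q -> 'I_n} := [ffun=> Ordinal n0].
pose F i j := odflt v0 [pick v | [&& v \in A, v \in S i & v \notin S j]].
have FE (i j : 'I_N) : i < j ->
    [/\ F i j \in A, F i j \in S i & F i j \notin S j].
  move=> ij; rewrite /F; case: pickP => [v /and3P[] //|h].
  by have [v vA vS] := hS _ _ ij; move: (h v); rewrite vA vS.
apply: (@avoid_path _ _ _ F) => // i j k ij jk.
have [A1 _ h1] := FE _ _ ij; have [A2 h2 _] := FE _ _ jk.
apply/existsP; apply: contraLR h2; rewrite negb_exists => /forallP h.
rewrite (hA _ _ A2 A1) // => c; by rewrite leqNgt h.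
Qed.

(** * A large layer of the grid *)

Local Open Scope ring_scope.

(** A primitive of a parabola for differences of step 2:
    cubic u (x + 1) - cubic u (x - 1) = u^2 - 1/3 - x^2. *)
Definition cubic (R : realFieldType) (u y : R) : R :=
  u ^+ 2 * y / 2 - y ^+ 3 / 6.

Definition clamp (R : realFieldType) (u y : R) : R :=
  if y <= - u then - u else if u <= y then u else y.

Lemma clamp_itv (R : realFieldType) (u y : R) : 0 <= u ->
  - u <= clamp u y /\ clamp u y <= u.
Proof.
by move=> u0; rewrite /clamp; case: (lerP y (- u)) => h1;
  last case: (lerP u y) => h2; split; lra.
Qed.

Lemma clamp_le (R : realFieldType) (u a b : R) : 0 <= u -> a <= b ->
  clamp u a <= clamp u b.
Proof.
move=> u0 ab; rewrite /clamp.
by case: (lerP a (- u)) => h1; case: (lerP b (- u)) => h2;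
  case: (lerP u a) => h3; case: (lerP u b) => h4; lra.
Qed.

(** [- u, u] is the interval between the two critical points of cubic u. *)
Lemma cubic_le (R : realFieldType) (u a b : R) : - u <= a -> a <= b -> b <= u ->
  cubic u a <= cubic u b.
Proof.
move=> ua ab bu; rewrite -subr_ge0 /cubic.
have -> : u ^+ 2 * b / 2 - b ^+ 3 / 6 - (u ^+ 2 * a / 2 - a ^+ 3 / 6) =
  (b - a) * (3 * u ^+ 2 - (a ^+ 2 + a * b + b ^+ 2)) / 6 by field.
have ha : a ^+ 2 <= u ^+ 2 by nra.
have hb : b ^+ 2 <= u ^+ 2 by nra.
have hab : 2 * (a * b) <= a ^+ 2 + b ^+ 2 by have := sqr_ge0 (a - b); lra.
by apply: divr_ge0 => //; apply: mulr_ge0; lra.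
Qed.

Lemma cubic_clampN (R : realFieldType) (u y : R) : 0 <= u ->
  cubic u (clamp u (- y)) = - cubic u (clamp u y).
Proof.
move=> u0; rewrite /clamp /cubic.
case: (lerP (- y) (- u)) => h1; case: (lerP y (- u)) => h2;
  case: (lerP u y) => h3; case: (lerP u (- y)) => h4;
  try (exfalso; lra); try by field.
(* Both bounds apply at once only if u = 0. *)
have -> : u = 0 by lra.
by field.
Qed.

(** For y >= u, this says that cubic u is at most its value at its local
    maximum u. *)
Lemma cubic_clamp_ge (R : realFieldType) (u y : R) : 0 <= u -> - u <= y ->
  cubic u y <= cubic u (clamp u y).
Proof.
move=> u0 yu; rewrite /clamp.
case: (lerP y (- u)) => h1; first by have -> : y = - u by lra.
case: (lerP u y) => h2 //; rewrite -subr_ge0 /cubic.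
have -> : u ^+ 2 * u / 2 - u ^+ 3 / 6 - (u ^+ 2 * y / 2 - y ^+ 3 / 6) =
  (y - u) ^+ 2 * (2 * u + y) / 6 by field.
by apply: divr_ge0 => //; apply: mulr_ge0; rewrite ?sqr_ge0//; lra.
Qed.

(** Freezing the primitive outside [- u, u] makes it monotone and can only
    increase its difference where the parabola is positive, so that it dominates
    the positive part of the parabola. *)
Lemma parabola_step (R : realFieldType) (u x : R) : 0 <= u ->
  Num.max 0 (u ^+ 2 - 3^-1 - x ^+ 2) <=
  cubic u (clamp u (x + 1)) - cubic u (clamp u (x - 1)).
Proof.
move=> u0; rewrite ge_max; apply/andP; split.
  rewrite subr_ge0; have [? _] := clamp_itv (x - 1) u0.
  have [_ ?] := clamp_itv (x + 1) u0.
  by apply: cubic_le => //; apply: clamp_le => //; lra.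
have [xu|ux] := lerP (x ^+ 2) (u ^+ 2); last first.
  apply: (@le_trans _ _ 0); first by lra.
  rewrite subr_ge0; have [? _] := clamp_itv (x - 1) u0.
  have [_ ?] := clamp_itv (x + 1) u0.
  by apply: cubic_le => //; apply: clamp_le => //; lra.
have xu1 : x <= u by nra.
have xu2 : - u <= x by nra.
have hp : cubic u (x + 1) <= cubic u (clamp u (x + 1)).
  by apply: cubic_clamp_ge => //; lra.
have hm : cubic u (- (x - 1)) <= cubic u (clamp u (- (x - 1))).
  by apply: cubic_clamp_ge => //; lra.
rewrite cubic_clampN // in hm.
have -> : u ^+ 2 - 3^-1 - x ^+ 2 = cubic u (x + 1) + cubic u (- (x - 1)).
  by rewrite /cubic; field.
lra.
Qed.

(** By [parabola_step] the sum is dominated by a telescoping one, and the frozen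
    primitive stays between - u^3/3 and u^3/3. *)
Lemma sum_parabola (R : realFieldType) (u c : R) (K : nat) : 0 <= u ->
  \sum_(k < K) Num.max 0 (u ^+ 2 - 3^-1 - (2 * k%:R - c) ^+ 2) <=
  2 / 3 * u ^+ 3.
Proof.
move=> u0.
pose g y := cubic u (clamp u y).
have gB y : g y <= u ^+ 3 / 3.
  have [? ?] := clamp_itv y u0.
  have -> : u ^+ 3 / 3 = cubic u u by rewrite /cubic; field.
  exact: cubic_le.
have gN y : g (- y) = - g y by apply: cubic_clampN.
suff H : \sum_(k < K) Num.max 0 (u ^+ 2 - 3^-1 - (2 * k%:R - c) ^+ 2) <=
    g (2 * K%:R - c - 1) - g (- (c + 1)).
  by apply: (le_trans H); have := gB (2 * K%:R - c - 1); have := gB (c + 1);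
    rewrite gN; lra.
elim: K => [|K IH].
  by rewrite big_ord0 (_ : _ - c - 1 = - (c + 1)) ?subrr //; ring.
rewrite big_ord_recr /=; have := parabola_step (2 * K%:R - c) u0.
rewrite -/(g _) -/(g (_ - 1)).
have -> : 2 * K.+1%:R - c - 1 = 2 * K%:R - c + 1 :> R by rewrite -natr1; ring.
lra.
Qed.

(** An integer distribution with small point masses has a large variance:
    grouped by the values of f, the total of the parabola contains each of its
    positive values at most M times. *)
Lemma sum_parabola_fibres (R : realFieldType) (T : finType) (f : T -> nat)
    (u c : R) (M : nat) : 0 <= u ->
  (forall s, (#|[set v | f v == s]| <= M)%N) ->
  \sum_(v : T) (u ^+ 2 - 3^-1 - (2 * (f v)%:R - c) ^+ 2) <=
  M%:R * (2 / 3 * u ^+ 3).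
Proof.
move=> u0 hM.
pose K := (\max_(v : T) f v).+1.
pose w (k : nat) := u ^+ 2 - 3^-1 - (2 * k%:R - c) ^+ 2 : R.
pose p v : 'I_K := inord (f v).
have pE v : p v = f v :> nat by rewrite /p inordK // ltnS leq_bigmax.
rewrite (partition_big p xpredT) //=.
apply: le_trans (ler_wpM2l (ler0n _ M) (sum_parabola c K u0)).
rewrite mulr_sumr; apply: ler_sum => k _.
rewrite (eq_bigr (fun=> w k)); last first.
  by move=> v /eqP <-; rewrite /w pE.
rewrite sumr_const -[w k *+ _]mulr_natl.
have le1 : w k <= Num.max 0 (w k) by rewrite le_max lexx orbT.
apply: le_trans (ler_wpM2l (ler0n _ _) le1) _.
rewrite -/(w k); apply: ler_wpM2r; first by rewrite le_max lexx.
rewrite ler_nat; apply: leq_trans (hM k).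
by rewrite subset_leq_card //; apply/subsetP=> v; rewrite inE -pE.
Qed.

(** The variance of a sum of independent centered variables: in the expanded
    square, the mixed products sum to zero. *)
Lemma second_moment (R : comNzRingType) (I J : finType) (y : J -> R) :
  \sum_j y j = 0 ->
  \sum_(v : {ffun I -> J}) (\sum_i y (v i)) ^+ 2 =
  #|I|%:R * #|J|%:R ^+ #|I|.-1 * \sum_j y j ^+ 2.
Proof.
move=> y0.
have E (v : {ffun I -> J}) : (\sum_i y (v i)) ^+ 2 =
    \sum_i \sum_k y (v i) * y (v k).
  by rewrite expr2 mulr_suml; apply: eq_bigr => i _; rewrite mulr_sumr.
rewrite (eq_bigr _ (fun v _ => E v)) exchange_big /=.
have prodE (i k : I) : \sum_(v : {ffun I -> J}) y (v i) * y (v k) =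
    \prod_l \sum_j (if l == i then y j else 1) * (if l == k then y j else 1).
  rewrite bigA_distr_bigA /=; apply: eq_bigr => v _.
  by rewrite big_split /= -!big_mkcond /= !big_pred1_eq.
transitivity (\sum_(i : I) #|J|%:R ^+ #|I|.-1 * \sum_j y j ^+ 2 : R); last first.
  by rewrite sumr_const -[LHS]mulr_natl mulrA.
apply: eq_bigr => i _; rewrite exchange_big /= (bigD1 i) //=
  [X in _ + X]big1 ?addr0.
  rewrite prodE (bigD1 i) //= mulrC; congr (_ * _).
    rewrite (eq_bigr (fun=> #|J|%:R)).
      by rewrite prodr_const cardC1.
    by move=> l /negPf->; under eq_bigr do rewrite mulr1; rewrite sumr_const.
  by apply: eq_bigr => j _; rewrite eqxx expr2.
move=> k ki; rewrite prodE (bigD1 i) //= eqxx eq_sym (negPf ki).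
by under eq_bigr do rewrite mulr1; rewrite y0 mul0r.
Qed.

Lemma sum_centered (R : numFieldType) (n : nat) :
  \sum_(j < n) (2 * j%:R - (n%:R - 1)) = 0 :> R.
Proof.
suff H (a : R) : \sum_(j < n) (2 * j%:R - a) = n%:R * (n%:R - 1 - a).
  by rewrite H subrr mulr0.
elim: n => [|n IH]; first by rewrite big_ord0 mul0r.
by rewrite big_ord_recr /= IH -natr1; ring.
Qed.

Lemma sum_centered2 (R : numFieldType) (n : nat) :
  \sum_(j < n) (2 * j%:R - (n%:R - 1)) ^+ 2 = n%:R * (n%:R ^+ 2 - 1) / 3 :> R.
Proof.
suff H (a : R) : \sum_(j < n) (2 * j%:R - a) ^+ 2 =
    n%:R * ((n%:R - 1) * (4 * n%:R - 2) / 3 - 2 * a * (n%:R - 1) + a ^+ 2).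
  by rewrite H; field.
elim: n => [|n IH]; first by rewrite big_ord0 mul0r.
by rewrite big_ord_recr /= IH -natr1; field.
Qed.

Definition weight (q n : nat) (v : {ffun 'I_q -> 'I_n}) : nat := (\sum_i v i)%N.

(** Layers are antichains: the coordinate sum is strictly monotone. *)
Lemma weight_le_eq (q n : nat) (v w : {ffun 'I_q -> 'I_n}) :
  (forall c, v c <= w c)%N -> weight v = weight w -> v = w.
Proof.
move=> le_vw eq_vw.
have [_] := leqif_sum (fun c (_ : true) => leqif_eq (le_vw c)).
rewrite -/(weight v) -/(weight w) eq_vw eqxx => /esym/forallP eqc.
by apply/ffunP => c; apply/val_inj/eqP; have := eqc c.
Qed.

(** The parabola with u^2 = q(n^2 - 1) + 1 gives the sharpest bound: its total
    over the grid is then (2/3) u^2 n^q, hence n^q <= L u for the size L of the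
    largest layer, and u <= n sqrt q. *)
Lemma large_layer (R : rcfType) (q n : nat) : (0 < q)%N -> (0 < n)%N ->
  exists s, n%:R ^+ (q - 1) / Num.sqrt q%:R <=
    #|[set v : {ffun 'I_q -> 'I_n} | weight v == s]|%:R :> R.
Proof.
move=> q0 n0.
pose layer s := [set v : {ffun 'I_q -> 'I_n} | weight v == s].
have [s hs] : exists s, forall r, (#|layer r| <= #|layer s|)%N.
  pose v0 : {ffun 'I_q -> 'I_n} := [ffun=> Ordinal n0].
  pose v1 := [arg max_(v > v0) #|layer (weight v)|]%N.
  exists (weight v1) => r.
  have [->|[v]] := set_0Vmem (layer r); first by rewrite cards0.
  by rewrite inE => /eqP <-; rewrite /v1; case: arg_maxnP => // w _; apply.
exists s; rewrite -/(layer s).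
pose y (j : 'I_n) : R := 2 * j%:R - (n%:R - 1).
have y0 : \sum_j y j = 0 by apply: sum_centered.
have := second_moment 'I_q y0.
rewrite sum_centered2 !card_ord => hX.
have wE (v : {ffun 'I_q -> 'I_n}) :
    \sum_i y (v i) = 2 * (weight v)%:R - q%:R * (n%:R - 1).
  rewrite sumrB -mulr_sumr sumr_const card_ord -[_ *+ q]mulr_natl.
  by rewrite /weight natr_sum.
have n1 : 1 <= n%:R :> R by rewrite ler1n.
have q1 : 1 <= q%:R :> R by rewrite ler1n.
pose A : R := q%:R * (n%:R ^+ 2 - 1) + 1.
have n2 : 1 <= n%:R ^+ 2 :> R by rewrite exprn_ege1.
have A0 : 0 < A by rewrite /A; nra.
pose u := Num.sqrt A.
have u0 : 0 < u by rewrite sqrtr_gt0.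
have uA : u ^+ 2 = A by rewrite sqr_sqrtr // ltW.
have := sum_parabola_fibres (q%:R * (n%:R - 1)) (ltW u0) hs.
rewrite big_split /= sumrN sumr_const card_ffun !card_ord.
rewrite -(eq_bigr _ (fun v _ => congr1 (fun z => z ^+ 2) (wE v))) hX.
rewrite -[_ *+ (n ^ q)]mulr_natl natrX subn1 => hM.
set L := #|_|%:R : R; rewrite -/L in hM.
set P := n%:R ^+ q.-1 : R; rewrite -/P in hM.
have nq : n%:R ^+ q = n%:R * P by rewrite -exprS prednK.
rewrite nq uA in hM.
have {hM}hM : (2/3 * u ^+ 2) * (n%:R * P) <= (2/3 * u ^+ 2) * (L * u).
  move: hM; rewrite [u ^+ 3]exprSr uA.
  suff -> : n%:R * P * (A - 3^-1) + - (q%:R * P * (n%:R * (n%:R ^+ 2 - 1) / 3))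
    = 2/3 * A * (n%:R * P) by lra.
  by rewrite /A; field.
rewrite ler_pM2l in hM; last by rewrite mulr_gt0 ?exprn_gt0 //; lra.
have uq : u <= n%:R * Num.sqrt q%:R.
  rewrite -[n%:R](ger0_norm (ler0n _ _)) -sqrtr_sqr -sqrtrM ?sqr_ge0 //.
  by rewrite ler_sqrt ?mulr_ge0 ?sqr_ge0 //; rewrite /A; lra.
rewrite ler_pdivrMr ?sqrtr_gt0 ?ltr0n //.
rewrite -(ler_pM2l (lt_le_trans ltr01 n1)); apply: le_trans hM _.
by rewrite mulrCA; apply: ler_wpM2l => //; apply: ler0n.
Qed.

(** * The bounds on N_3(q, n) *)

Unset Implicit Arguments.

Theorem corollary1 (R : realType) (q n : nat) (hq : (2 <= q)%N)
    (hn : (2 <= n)%N) :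
  (2 : R) `^ (2 / 3 * (n%:R ^+ (q - 1)) / Num.sqrt q%:R) <= (N3 q n)%:R
    /\ (N3 q n)%:R <= (2 : R) ^+ (2 * n ^ (q - 1))%N.
Proof.
have n0 : (0 < n)%N by apply: ltnW.
split; last first.
  case: q hq => [|[|p]] // _; rewrite -natrX ler_nat subn1.
  exact: N3_upper.
have [s] := large_layer R (ltnW hq) n0.
set A := [set v | _] => hA.
have antiA : {in A &, forall v w : {ffun 'I_q -> 'I_n},
    (forall c, v c <= w c)%N -> v = w}.
  move=> v w; rewrite !inE => /eqP wv /eqP ww le_vw.
  by apply: weight_le_eq => //; rewrite wv ww.
have hN : (2 ^ #|A|)%:R <= (N3 q n)%:R :> R.
  by rewrite ler_nat ltnW // antichain_bound.
apply: le_trans hN; rewrite natrX -powR_mulrn //.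
apply: ler_powR; first by rewrite ler1n.
apply: le_trans hA; rewrite -mulrA ler_piMl ?divr_ge0 ?exprn_ge0 ?sqrtr_ge0 //.
by lra.
Qed.
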